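(* Let $A$ be an integral domain and $E$ a finitely generated comultiplication $A$-module such that $\operatorname{ann}(E)$ is a semiprime ideal. Then $E$ is a quasi second $A$-module if and only if one of the following conditions holds: (i) $E$ is a simple module; (ii) $E=eE\oplus(1-e)E$ for some weak idempotent $e\in A$, where $eE$ and $(1-e)E$ are minimal submodules of $E$. In this case $E=Am\oplus Am'$ (for some $m,m'\in E$) is a semisimple module.
   Context: $\operatorname{ann}(E)=\{a\in A: aE=0\}$. $E$ is a quasi second module if for all $a,b\in A$, $0\neq bE\subseteq aE\neq E$ implies $bE=aE$. $E$ is a comultiplication module if for every submodule $N$ of $E$ there is an ideal $I$ of $A$ with $N=\operatorname{ann}_E(I)=\{m\in E: Im=0\}$. A proper ideal $I$ of $A$ is semiprime if $a^n\in I$ ($a\in A$, $n\ge 1$) implies $a\in I$. An element $r\in A$ is a weak idempotent (with respect to $E$) if $r^2-r\in\operatorname{ann}(E)$. *)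

(* Defs.v *)
From mathcomp Require Import all_boot all_algebra.
From mathcomp Require Import boolp classical_sets functions cardinality fsbigop.

Set Implicit Arguments.
Unset Strict Implicit.
Unset Printing Implicit Defensive.

Import GRing.Theory.

Local Open Scope classical_set_scope.
Local Open Scope ring_scope.

(* Submodules and ideals are arbitrary subsets, [set E], closed under the module
   operations; [is_ideal] does not require the ideal to be proper. *)
Definition is_submodule (A : comNzRingType) (E : lmodType A) (N : set E) : Prop :=
  GRing.submod_closed [in N].

Definition is_ideal (A : comNzRingType) (I : set A) : Prop :=
  @is_submodule A A^o I.

Definition smul (A : comNzRingType) (E : lmodType A) (a : A) : set E :=
  [set a *: x | x in [set: E]].
Arguments smul {A} E a.

Definition ann (A : comNzRingType) (E : lmodType A) : set A :=
  [set a | smul E a = [set 0]].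
Arguments ann {A} E.

Definition ann_in (A : comNzRingType) (E : lmodType A) (I : set A) : set E :=
  [set m | forall a, I a -> a *: m = 0].
Arguments ann_in {A} E I.

Definition cyclic_submodule (A : comNzRingType) (E : lmodType A) (m : E) : set E :=
  [set a *: m | a in [set: A]].

Definition finitely_generated (A : comNzRingType) (E : lmodType A) : Prop :=
  exists (n : nat) (g : 'I_n -> E), forall x : E,
  exists c : 'I_n -> A, x = \sum_(i < n) c i *: g i.

Definition comultiplication_module (A : comNzRingType) (E : lmodType A) : Prop :=
  forall N : set E, is_submodule N ->
  exists I : set A, is_ideal I /\ N = ann_in E I.

Definition quasi_second (A : comNzRingType) (E : lmodType A) : Prop :=
  forall a b : A,
    smul E b <> [set 0] -> smul E b `<=` smul E a -> smul E a <> [set: E] ->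
    smul E b = smul E a.

Definition semiprime_ideal (A : comNzRingType) (I : set A) : Prop :=
  [/\ is_ideal I, I <> [set: A]
    & forall (a : A) (n : nat), (1 <= n)%N -> I (a ^+ n) -> I a].

Definition weak_idempotent (A : comNzRingType) (E : lmodType A) (r : A) : Prop :=
  ann E (r ^+ 2 - r).
Arguments weak_idempotent {A} E r.

(* Minimal among the nonzero submodules, i.e. simple as a module. *)
Definition minimal_submodule (A : comNzRingType) (E : lmodType A) (N : set E) : Prop :=
  [/\ is_submodule N, N <> [set 0]
    & forall K : set E, is_submodule K -> K `<=` N -> K = [set 0] \/ K = N].

Definition simple_module (A : comNzRingType) (E : lmodType A) : Prop :=
  [set: E] <> [set 0] /\
  forall K : set E, is_submodule K -> K = [set 0] \/ K = [set: E].

Definition direct_sum2 (A : comNzRingType) (E : lmodType A) (N K : set E) : Prop :=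
  [/\ is_submodule N, is_submodule K,
      forall x : E, exists y z : E, [/\ N y, K z & x = y + z]
    & N `&` K = [set 0]].

(* E is the internal direct sum of the submodules S i: every element is uniquely
   a sum of components f i in S i, all but finitely many of which vanish.  The
   finite support is required explicitly because [\sum_(i \in D) f i] is 0 when
   f has infinite support. *)
Definition direct_sum (A : comNzRingType) (E : lmodType A)
    (I : choiceType) (S : I -> set E) : Prop :=
  (forall i, is_submodule (S i)) /\
  forall x : E, exists! f : I -> E,
    [/\ forall i, S i (f i), finite_set [set i | f i <> 0]
      & x = \sum_(i \in [set: I]) f i].

Definition semisimple_module (A : comNzRingType) (E : lmodType A) : Prop :=
  exists (I : choiceType) (S : I -> set E),
    (forall i, minimal_submodule (S i)) /\ direct_sum S.

Definition weak_idempotent_splitting (A : comNzRingType) (E : lmodType A) (e : A)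
    : Prop :=
  [/\ weak_idempotent E e,
      direct_sum2 (smul E e) (smul E (1 - e)),
      minimal_submodule (smul E e)
    & minimal_submodule (smul E (1 - e))].
Arguments weak_idempotent_splitting {A} E e.
Arguments finitely_generated {A} E.
Arguments comultiplication_module {A} E.
Arguments quasi_second {A} E.
Arguments simple_module {A} E.
Arguments semisimple_module {A} E.

(* Main.v *)
Require Import Defs.
From mathcomp Require Import all_boot all_algebra.
From mathcomp Require Import boolp classical_sets functions cardinality fsbigop.

(** Finite generation enters through the determinant form of Nakayama's lemma
    ([nakayama]): if eE is contained in aeE, then a is invertible modulo the
    annihilator of eE.

    The comultiplication hypothesis is used through [minimal_smul]: a nonzero
    eE on which every scalar acts either as zero or surjectively is a minimal
    submodule.  Indeed a scalar acting surjectively on eE is injective there by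
    Nakayama, so it cannot kill a nonzero K inside eE; writing K = ann_E(I),
    every element of I must then act as zero on eE, whence eE is inside K.

    If every aE is 0 or E, this applies to e = 1 and E is simple.  Otherwise
    some aE is neither 0 nor E.  Semiprimeness makes a^2 E nonzero, so the quasi
    second property gives a^2 E = aE, and Nakayama yields t with a t acting as
    the identity on aE.  Hence e = a t is a weak idempotent with eE = aE, and E
    is the direct sum of eE and (1-e)E.  Both are proper and nonzero, so the
    quasi second property says that scalars act on each of them by zero or
    surjectively, and [minimal_smul] makes both minimal
    ([splitting_of_quasi_second]).

    Conversely, when such a splitting is given, aE is the sum of a(eE) and
    a((1-e)E), so that minimality leaves only 0, eE, (1-e)E and E as possible
    values of aE ([smul_splitting]); neither of eE and (1-e)E contains the
    other, which gives the quasi second property.  Minimal submodules are generated by any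
    of their nonzero elements, hence the last assertion. *)

Set Implicit Arguments.
Unset Strict Implicit.
Unset Printing Implicit Defensive.

Import GRing.Theory.

Local Open Scope classical_set_scope.
Local Open Scope ring_scope.

(** * Submodules and minimal submodules *)

Section Submodules.
Variables (A : comNzRingType) (E : lmodType A).
Implicit Types (a b e : A) (N K : set E).

Lemma is_submoduleP N :
  is_submodule N <-> N 0 /\ forall a x y, N x -> N y -> N (a *: x + y).
Proof.
split=> [[N0 NL]|[N0 NL]].
  split=> [|a x y Nx Ny]; first by move: N0; rewrite inE.
  by have := NL a x y; rewrite !inE; apply.
by split=> [|a x y]; rewrite !inE //; apply: NL.
Qed.

Lemma submodule0 N : is_submodule N -> N 0.
Proof. by case/is_submoduleP. Qed.

Lemma submoduleD N x y : is_submodule N -> N x -> N y -> N (x + y).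
Proof. by case/is_submoduleP=> _ NL Nx Ny; rewrite -[x]scale1r; apply: NL. Qed.

Lemma submoduleZ N a x : is_submodule N -> N x -> N (a *: x).
Proof. by case/is_submoduleP=> N0 NL Nx; rewrite -[_ *: _]addr0; apply: NL. Qed.

Lemma submoduleB N x y : is_submodule N -> N x -> N y -> N (x - y).
Proof.
by move=> sN Nx Ny; rewrite -scaleN1r; apply: submoduleD => //; apply: submoduleZ.
Qed.

Lemma smul_submodule a : is_submodule (smul E a).
Proof.
apply/is_submoduleP; split; first by exists 0; rewrite ?scaler0.
move=> b _ _ [x _ <-] [y _ <-]; exists (b *: x + y) => //.
by rewrite scalerDr !scalerA mulrC.
Qed.

Lemma cyclic_submodule_submodule (m : E) : is_submodule (cyclic_submodule m).
Proof.
apply/is_submoduleP; split; first by exists 0; rewrite ?scale0r.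
move=> b _ _ [x _ <-] [y _ <-]; exists (b * x + y) => //.
by rewrite scalerDl scalerA.
Qed.

Lemma submodule_neq0 N : is_submodule N -> N <> [set 0] -> exists2 x, N x & x <> 0.
Proof.
move=> sN N0; apply: contrapT => H; case: N0.
apply/seteqP; split=> [x Nx|_ ->]; last exact: submodule0.
by apply: contrapT => x0; apply: H; exists x.
Qed.

Lemma smul_eq0 a : smul E a = [set 0] <-> forall x : E, a *: x = 0.
Proof.
split=> [aE x|a0].
  have : smul E a (a *: x) by exists x.
  by rewrite aE.
apply/seteqP; split=> [_ [x _ <-]|_ ->]; first exact: a0.
by exists 0; rewrite ?scaler0.
Qed.

Lemma smul1 : smul E 1 = [set: E].
Proof. by apply/seteqP; split=> // x _; exists x; rewrite ?scale1r. Qed.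

Lemma smulM_sub b a : smul E (b * a) `<=` smul E a.
Proof. by move=> _ [x _ <-]; exists (b *: x); rewrite // scalerA mulrC. Qed.

Lemma simple_moduleE : simple_module E <-> minimal_submodule [set: E].
Proof.
split=> [[E0 EK]|[_ E0 EK]]; last by split=> // K sK; apply: EK.
by split=> // [|K sK _]; [apply/is_submoduleP | apply: EK].
Qed.

Lemma minimal_cyclic N m :
  minimal_submodule N -> N m -> m <> 0 -> N = cyclic_submodule m.
Proof.
move=> [sN _ minN] Nm m0.
have [_ [a _ <-]|Am0|->//] := minN _ (cyclic_submodule_submodule m).
  exact: submoduleZ.
have : cyclic_submodule m m by exists 1; rewrite ?scale1r.
by rewrite Am0.
Qed.

Lemma minimal_is_cyclic N :
  minimal_submodule N -> exists m, N = cyclic_submodule m.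
Proof.
move=> minN; have [sN N0 _] := minN.
have [m Nm m0] := submodule_neq0 sN N0.
by exists m; apply: minimal_cyclic.
Qed.

(** The decomposition is indexed by the booleans; uniqueness of the components
    holds because the difference of two candidates lies in N and in K. *)
Lemma semisimple_of_direct_sum2 N K :
  minimal_submodule N -> minimal_submodule K -> direct_sum2 N K ->
  semisimple_module E.
Proof.
move=> minN minK [sN sK NKE NK0].
have sumb (f : bool -> E) : \sum_(i \in [set: bool]) f i = f true + f false.
  have -> : [set: bool] = [set` [:: true; false]].
    by apply/seteqP; split=> // -[].
  by rewrite -fsbig_seq // big_cons big_seq1.
exists bool, (fun i => if i then N else K); split; first by case.
split=> [[] //|x].
have [y [z [Ny Kz ->]]] := NKE x.
exists (fun i : bool => if i then y else z); split.
  by split; [case | exact: finite_finset | rewrite sumb].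
move=> f [fNK _]; rewrite sumb => fE.
have Nf : N (y - f true) by apply: submoduleB => //; exact: (fNK true).
have Kf : K (f false - z) by apply: submoduleB => //; exact: (fNK false).
have yzE : y - f true = f false - z.
  by apply/eqP; rewrite subr_eq addrAC eq_sym subr_eq addrC -fE.
have : (N `&` K) (y - f true) by split=> //; rewrite yzE.
rewrite NK0 /= => y0; apply/funext => -[]; first exact/subr0_eq.
by apply/esym/subr0_eq; rewrite -yzE.
Qed.

End Submodules.

(** * Nakayama's lemma *)

(** Cramer's rule for vectors in a module: multiply the relations by the
    adjugate matrix. *)
Lemma det_scale_eq0 (A : comNzRingType) (E : lmodType A) n
    (M : 'M[A]_n) (v : 'I_n -> E) :
  (forall i, \sum_j M i j *: v j = 0) -> forall j, \det M *: v j = 0.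
Proof.
move=> Mv j.
have -> : \det M *: v j = \sum_k (\adj M *m M) j k *: v k.
  rewrite mul_adj_mx (bigD1 j) //= big1 => [|k kj].
    by rewrite mxE eqxx mulr1n addr0.
  by rewrite mxE eq_sym (negPf kj) mulr0n scale0r.
under eq_bigr do rewrite mxE scaler_suml.
rewrite exchange_big big1 //= => i _.
under eq_bigr do rewrite -scalerA.
by rewrite -scaler_sumr Mv scaler0.
Qed.

(** The determinant is the value at a of the polynomial det(1 - XC), whose
    constant term is 1. *)
Lemma det_one_sub_scale (A : comNzRingType) n (a : A) (C : 'M[A]_n) :
  exists t, \det (1%:M - a *: C) = 1 - a * t.
Proof.
pose p := \det (1%:M - 'X *: map_mx polyC C).
have pE b : p.[b] = \det (1%:M - b *: C).
  rewrite -[_.[_]]/(horner_eval b p) -det_map_mx; congr (\det _).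
  by apply/matrixP=> i j; rewrite !mxE /= /horner_eval !hornerE hornerMn hornerC.
have /factor_theorem[q pq] : root (p - 1) 0.
  by rewrite /root !hornerE pE scale0r subr0 det1 subrr.
exists (- q.[a]); rewrite -pE -[p](subrK 1) pq !hornerE.
by rewrite subr0 mulrN opprK mulrC addrC.
Qed.

Section FinitelyGenerated.
Variables (A : comNzRingType) (E : lmodType A).
Hypothesis E_fg : finitely_generated E.
Implicit Types (a b e : A) (N K : set E).

(** Writing e g_i = a e sum_j c_ij g_j on generators g_i, the matrix 1 - aC
    kills the vector (e g_i), hence so does its determinant 1 - at. *)
Lemma nakayama e a :
  smul E e `<=` smul E (a * e) ->
  exists t, forall x : E, (1 - a * t) *: (e *: x) = 0.
Proof.
have [n [g gE]] := E_fg => eE.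
have /choice[c cE] (i : 'I_n) :
    exists c : 'I_n -> A, e *: g i = (a * e) *: \sum_(j < n) c j *: g j.
  have [|y _ <-] := eE (e *: g i); first by exists (g i).
  by have [c ->] := gE y; exists c.
have [t tE] := det_one_sub_scale a (\matrix_(i, j) c i j).
exists t => x; have [d ->] := gE x.
rewrite !scaler_sumr big1 // => i _.
have -> : (1 - a * t) *: (e *: (d i *: g i)) = d i *: ((1 - a * t) *: (e *: g i)).
  by rewrite !scalerA; congr (_ *: _); rewrite mulrA mulrC mulrA.
rewrite -tE (_ : _ *: (e *: g i) = 0) ?scaler0 //.
apply: (det_scale_eq0 (v := fun i => e *: g i)) => {}i.
under eq_bigr do rewrite !mxE scalerBl.
rewrite sumrB (bigD1 i) //= eqxx scale1r big1 => [|j ji]; last first.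
  by rewrite eq_sym (negPf ji) scale0r.
rewrite addr0 cE scaler_sumr -sumrB big1 // => j _.
by rewrite !scalerA mulrAC subrr.
Qed.

(** * Minimality in comultiplication modules *)

Hypothesis E_comult : comultiplication_module E.

(** The second hypothesis says that eE is a second module.  An ideal I
    defining a nonzero submodule K of eE cannot contain any i acting
    surjectively on eE, for such an i is injective on eE but kills K. *)
Lemma minimal_smul e :
  smul E e <> [set 0] ->
  (forall b, smul E (b * e) = [set 0] \/ smul E (b * e) = smul E e) ->
  minimal_submodule (smul E e).
Proof.
move=> e0 eM; split=> // [|K sK KeE]; first exact: smul_submodule.
apply: contrapT => /not_orP[K0 KneqeE]; apply: KneqeE.
apply/seteqP; split=> // _ [x _ <-].
have [I [_ KI]] := E_comult sK; rewrite KI => i Ii.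
have [ie0|ieE] := eM i.
  by move/smul_eq0: ie0 => /(_ x); rewrite scalerA.
have [t tE] : exists t, forall x : E, (1 - i * t) *: (e *: x) = 0.
  by apply: nakayama; rewrite ieE.
have [y Ky y0] := submodule_neq0 sK K0; case: y0.
have [z _ zy] := KeE y Ky; have := tE z; rewrite zy scalerBl scale1r.
move/subr0_eq => ->; rewrite mulrC -scalerA.
by move: Ky; rewrite KI => /(_ i Ii) ->; rewrite scaler0.
Qed.

(** As beE is contained in eE, the quasi second property applied to the pair
    (e, be) is the dichotomy that [minimal_smul] asks for. *)
Lemma minimal_smul_quasi_second e :
  quasi_second E -> smul E e <> [set 0] -> smul E e <> [set: E] ->
  minimal_submodule (smul E e).
Proof.
move=> qE e0 eE; apply: minimal_smul => // b.
have [->|be0] := EM (smul E (b * e) = [set 0]); [by left | right].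
by apply: qE => //; apply: smulM_sub.
Qed.

Lemma simple_of_smul_trivial :
  [set: E] <> [set 0] ->
  (forall a, smul E a = [set 0] \/ smul E a = [set: E]) -> simple_module E.
Proof.
move=> E0 aE; apply/simple_moduleE; rewrite -smul1; apply: minimal_smul.
  by rewrite smul1.
by move=> b; rewrite mulr1 smul1.
Qed.

End FinitelyGenerated.

(** * Weak idempotents and splittings *)

Section Splitting.
Variables (A : comNzRingType) (E : lmodType A).
Implicit Types (a b e : A) (N K : set E).

Lemma weak_idempotentP e :
  weak_idempotent E e <-> forall x : E, e *: (e *: x) = e *: x.
Proof.
rewrite /weak_idempotent /ann /= smul_eq0; split=> eE x.
  by apply: subr0_eq; rewrite scalerA -scalerBl -expr2.
by rewrite scalerBl expr2 -scalerA eE subrr.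
Qed.

Lemma weak_idempotent_direct_sum e :
  weak_idempotent E e -> direct_sum2 (smul E e) (smul E (1 - e)).
Proof.
move=> /weak_idempotentP ee; split; try exact: smul_submodule.
  move=> x; exists (e *: x), ((1 - e) *: x).
  by split; [exists x | exists x | rewrite -scalerDl addrC subrK scale1r].
apply/seteqP; split=> [x [[y _ <-] [z _ zE]]|_ ->]; last first.
  by split; apply: submodule0; apply: smul_submodule.
by rewrite /= -ee -zE scalerBl scale1r scalerBr ee subrr.
Qed.

Lemma smul_decomp e a :
  smul E a = [set y + z | y in smul E (a * e) & z in smul E (a * (1 - e))].
Proof.
apply/seteqP; split=> [_ [x _ <-]|_ [_ [y _ <-] [_ [z _ <-] <-]]].
  exists ((a * e) *: x); first by exists x.
  exists ((a * (1 - e)) *: x); first by exists x.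
  by rewrite -scalerDl -mulrDr addrC subrK mulr1.
exists (e *: y + (1 - e) *: z) => //.
by rewrite scalerDr !scalerA.
Qed.

(** By minimality a(eE) is 0 or eE and a((1-e)E) is 0 or (1-e)E; the four
    combinations are the four values. *)
Lemma smul_splitting e a : weak_idempotent_splitting E e ->
  [\/ smul E a = [set 0], smul E a = smul E e, smul E a = smul E (1 - e)
    | smul E a = [set: E]].
Proof.
move=> [_ [_ _ EE _] [_ _ min_e] [_ _ min_f]].
have sum0l (N : set E) : [set y + z | y in [set 0] & z in N] = N.
  apply/seteqP; split=> [_ [_ -> [z Nz <-]]|z Nz]; first by rewrite add0r.
  by exists 0 => //; exists z; rewrite ?add0r.
have sum0r (N : set E) : [set y + z | y in N & z in [set 0]] = N.
  apply/seteqP; split=> [_ [y Ny [_ -> <-]]|y Ny]; first by rewrite addr0.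
  by exists y => //; exists 0; rewrite ?addr0.
rewrite (smul_decomp e a).
have := min_f _ (smul_submodule E (a * (1 - e))) (@smulM_sub _ _ _ _).
have := min_e _ (smul_submodule E (a * e)) (@smulM_sub _ _ _ _).
case=> ->; case=> ->; rewrite ?sum0l ?sum0r; [exact: Or41|exact: Or43|exact: Or42|].
apply: Or44; apply/seteqP; split=> // x _.
by have [y [z [ey fz ->]]] := EE x; exists y => //; exists z.
Qed.

Lemma quasi_second_of_simple : simple_module E -> quasi_second E.
Proof.
move=> [_ EK] a b b0 ba aE.
have [//|bE] := EK _ (smul_submodule E b).
by case: aE; apply/seteqP; split=> //; rewrite -bE.
Qed.

(** By [smul_splitting] both aE and bE are among eE and (1-e)E, and neither of
    these contains the other since they are nonzero and meet in 0. *)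
Lemma quasi_second_of_splitting e :
  weak_idempotent_splitting E e -> quasi_second E.
Proof.
move=> eS a b b0 ba aE.
have [_ [_ _ _ I0] [_ e0 _] [_ f0 _]] := eS.
have [a0|aeE|afE|//] := smul_splitting a eS.
- case: b0; apply/seteqP; split; first by rewrite -a0.
  by move=> _ ->; apply: submodule0; apply: smul_submodule.
- have [//|->//|bfE|bE] := smul_splitting b eS.
    by case: f0; rewrite -I0; apply/esym/setIidr; rewrite -bfE -aeE.
  by case: aE; apply/seteqP; split=> //; rewrite -bE.
- have [//|beE|->//|bE] := smul_splitting b eS.
    by case: e0; rewrite -I0; apply/esym/setIidl; rewrite -beE -afE.
  by case: aE; apply/seteqP; split=> //; rewrite -bE.
Qed.

End Splitting.

(** The idempotent is a t, where t is an inverse of a modulo the annihilator of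
    aE; it exists by Nakayama because a^2 E = aE. *)
Lemma splitting_of_quasi_second (A : comNzRingType) (E : lmodType A) (a : A) :
  finitely_generated E -> comultiplication_module E ->
  semiprime_ideal (ann E) -> quasi_second E ->
  smul E a <> [set 0] -> smul E a <> [set: E] ->
  exists e, weak_idempotent_splitting E e.
Proof.
move=> E_fg E_comult [_ _ E_sp] qE a0 aE.
(* a^2 does not annihilate E, since the annihilator is semiprime. *)
have aaE : smul E (a * a) = smul E a.
  by apply: qE => // [aa0|]; [case: a0; exact: (E_sp a 2) | exact: smulM_sub].
have [t tE] : exists t, forall x : E, (1 - a * t) *: (a *: x) = 0.
  by apply: nakayama; rewrite ?aaE.
have atE (x : E) : (a * t) *: (a *: x) = a *: x.
  by apply/esym/subr0_eq; rewrite -[X in X - _]scale1r -scalerBl tE.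
have eE : smul E (a * t) = smul E a.
  apply/seteqP; split=> [|_ [x _ <-]]; first by rewrite mulrC; exact: smulM_sub.
  by rewrite -atE; exists (a *: x).
have idem : weak_idempotent E (a * t).
  by apply/weak_idempotentP=> x; rewrite -(scalerA a t x) atE.
have dE := weak_idempotent_direct_sum idem.
have [_ _ EE I0] := dE.
exists (a * t); split=> //; apply: minimal_smul_quasi_second; rewrite ?eE //.
  move=> f0; case: aE; apply/seteqP; split=> // x _.
  by have [y [z [ey]]] := EE x; rewrite f0 => -> ->; rewrite addr0 -eE.
by move=> fT; case: a0; rewrite -I0 fT setIT eE.
Qed.

Theorem theorem10 (A : idomainType) (E : lmodType A)
    (E_fg : finitely_generated E)
    (E_comult : comultiplication_module E)
    (annE_semiprime : semiprime_ideal (ann E)) :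
  (quasi_second E <->
    (simple_module E \/ exists e : A, weak_idempotent_splitting E e)) /\
  (forall e : A, weak_idempotent_splitting E e ->
    (exists m m' : E,
      [/\ smul E e = cyclic_submodule m,
          smul E (1 - e)%R = cyclic_submodule m'
        & direct_sum2 (cyclic_submodule m) (cyclic_submodule m')]) /\
    semisimple_module E).
Proof.
split; last first.
  move=> e [_ dE min_e min_f]; split; last exact: semisimple_of_direct_sum2 dE.
  have [[m mE] [m' m'E]] := (minimal_is_cyclic min_e, minimal_is_cyclic min_f).
  by exists m, m'; rewrite -mE -m'E.
split=> [qE|[|[e]]]; last 2 first.
- exact: quasi_second_of_simple.
- exact: quasi_second_of_splitting.
have E0 : [set: E] <> [set 0].
  have [_ annT _] := annE_semiprime => E0; apply: annT; apply/seteqP; split=> // a _.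
  by apply/smul_eq0 => x; have : [set: E] (a *: x) by []; rewrite E0.
have [aE|/existsNP[a /not_orP[a0 aE]]] :=
  pselect (forall a, smul E a = [set 0] \/ smul E a = [set: E]).
  by left; apply: simple_of_smul_trivial.
by right; apply: splitting_of_quasi_second a0 aE.
Qed.
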